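(* Suppose that $J:\mathcal{P}(\mathcal{X})\to\mathbb{R}$ is convex and $L$-smooth, let $\mu^*\in\arg\min_{\mu\in\mathcal{P}(\mathcal{X})}J(\mu)$, and let $R=\sup\{\|\mu_1-\mu_2\|:\mu_1,\mu_2\in\mathcal{P}(\mathcal{X})\}$. Suppose that there exists $c_0<\infty$ such that for all $\mu\in\mathcal{P}(\mathcal{X})$ (and all sample sizes $m\ge1$) $$\mathbb{E}\left[\sqrt m\,\|H_{\mu,m}-h_\mu\|_\infty\right]\le c_0.$$ Let $\{\mu_k\}$ be generated, from $\mu_0\in\mathcal{P}(\mathcal{X})$, by the stochastic Frank-Wolfe recursion $$\mu_{k+1}=(1-\eta_k)\mu_k+\eta_k\,\delta_{\hat x_{k+1}(m_{k+1})},\qquad \hat x_{k+1}(m_{k+1})\in\arg\min_{x\in\mathcal{X}}H_{\mu_k,m_{k+1}}(x),\qquad k\ge0,$$ with $$\eta_k=\frac{2}{k+2},\qquad m_k\ge\left(\frac{c_0(k+2)}{LR}\right)^2.$$ Then $$\mathbb{E}\left[J(\mu_k)-J(\mu^* )\right]\le\frac{4LR^2}{k+2},\qquad k\ge1.$$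
   Context: $\mathcal{X}$ is a nonempty compact subset of $\mathbb{R}^d$ with Borel $\sigma$-algebra $\mathcal{B}(\mathcal{X})$, $\mathcal{P}(\mathcal{X})$ is the set of Borel probability measures on $\mathcal{X}$, and $\delta_x$ is the Dirac measure at $x$. The functional $J$ is convex if $J((1-t)\mu+t\nu)\le(1-t)J(\mu)+tJ(\nu)$ for all $\mu,\nu\in\mathcal{P}(\mathcal{X})$, $t\in[0,1]$. The influence function of $J$ at $\mu$ is $h_\mu(x)=\lim_{t\to0^+}\frac1t\{J(\mu+t(\delta_x-\mu))-J(\mu)\}$, $x\in\mathcal{X}$. The von Mises derivative of $J$ at $\mu$ is $J'_\mu(\nu)=\lim_{t\to0^+}\frac1t\{J(\mu+t(\nu-\mu))-J(\mu)\}$; it exists at $\mu$ if these limits exist for all $\nu\in\mathcal{P}(\mathcal{X})$ and there is a measurable $\phi_\mu:\mathcal{X}\to\mathbb{R}$, integrable with respect to every $\nu\in\mathcal{P}(\mathcal{X})$, with $J'_\mu(\nu)=\int\phi_\mu\,\mathrm{d}(\nu-\mu)$. Then $h_\mu=\phi_\mu-\int\phi_\mu\,\mathrm{d}\mu$ and $J'_\mu(\nu)=\int h_\mu\,\mathrm{d}\nu$. Total variation distance: $\|\mu_1-\mu_2\|:=\sup_{A\in\mathcal{B}(\mathcal{X})}|\mu_1(A)-\mu_2(A)|$. $J$ is $L$-smooth ($L>0$) if $\sup_{x\in\mathcal{X}}|h_{\mu_1}(x)-h_{\mu_2}(x)|\le L\|\mu_1-\mu_2\|$ for all $\mu_1,\mu_2\in\mathcal{P}(\mathcal{X})$.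 Stochastic oracle: $Y$ is a random element of a measurable space, $H_\mu(\cdot,Y):\mathcal{X}\to\mathbb{R}$ is a random function with $\mathbb{E}[H_\mu(x,Y)]=h_\mu(x)$ for all $\mu,x$, and $H_{\mu,m}(x)=\frac1m\sum_{j=1}^m H_\mu(x,Y_j)$ with $Y_1,\dots,Y_m$ i.i.d. copies of $Y$; $\|g\|_\infty=\sup_{x\in\mathcal{X}}|g(x)|$. At iteration $k$, $H_{\mu_k,m_{k+1}}$ is formed from $m_{k+1}$ fresh i.i.d. copies of $Y$, independent of the samples used to construct $\mu_0,\dots,\mu_k$. Standing assumptions: the von Mises derivative of $J$ exists at every $\mu\in\mathcal{P}(\mathcal{X})$, each $H_{\mu_k,m_{k+1}}$ attains its minimum on $\mathcal{X}$, $R>0$, and all random quantities are measurable. *)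

(* Defs.v *)
From HB Require Import structures.
From mathcomp Require Import all_boot all_order all_algebra.
From mathcomp Require Import all_classical all_reals all_analysis.
From mathcomp Require Import measurable_realfun.

Set Implicit Arguments.
Unset Strict Implicit.
Unset Printing Implicit Defensive.

Import Order.TTheory GRing.Theory Num.Theory.
Import numFieldNormedType.Exports.

Local Open Scope classical_set_scope.
Local Open Scope ring_scope.

(* The subtype of points of X with the topology induced from R^d. The witness
   X0 is there because a measurableType must be pointed. *)
Definition subspace_of (R : realType) (d : nat) (X : set 'rV[R]_d)
    (X0 : X !=set0) : Type := set_type X.

Section subspace_of_instances.
Context (R : realType) (d : nat) (X : set 'rV[R]_d) (X0 : X !=set0).

HB.instance Definition _ :=
  Topological.copy (subspace_of X0) (set_type X).
HB.instance Definition _ := isPointed.Build (subspace_of X0)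
  (exist (fun x => x \in X) (sval (cid X0)) (mem_set (svalP (cid X0)))).

End subspace_of_instances.

Definition borel (R : realType) (d : nat) (X : set 'rV[R]_d)
    (X0 : X !=set0) : measurableType (@open (subspace_of X0)).-sigma :=
  g_sigma_algebraType (@open (subspace_of X0)).

Section mixture.
Context d (T : measurableType d) (R : realType).
Variables (t : R) (mu nu : probability T R).
Local Open Scope ereal_scope.

(* (1 - t) mu + t nu for t in [0, 1]; the value mu outside [0, 1] only makes
   the operation total. *)
Definition mixture (A : set T) : \bar R :=
  if (0 <= t <= 1)%R then (1 - t)%:E * mu A + t%:E * nu A else mu A.

Let mixture0 : mixture set0 = 0.
Proof. rewrite /mixture; case: ifP => _; by rewrite ?measure0 ?mule0 ?adde0. Qed.

Let mixture_ge0 A : 0 <= mixture A.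
Proof.
rewrite /mixture; case: ifPn => // /andP[t0 t1].
by apply: adde_ge0; apply: mule_ge0; rewrite ?lee_fin ?subr_ge0.
Qed.

Let mixture_sigma_additive : semi_sigma_additive mixture.
Proof.
have [t01|t01] := boolP (0 <= t <= 1)%R; last first.
  have -> : mixture = mu by apply/funext => A; rewrite /mixture (negbTE t01).
  exact: measure_semi_sigma_additive.
have -> : mixture = (fun A => (1 - t)%:E * mu A + t%:E * nu A).
  by apply/funext => A; rewrite /mixture t01.
case/andP: t01 => t0 t1.
have t1' : (0 <= 1 - t)%R by rewrite subr_ge0.
move=> F mF tF mUF.
rewrite [X in X @ _ --> _](_ : _ =
    (fun n => (1 - t)%:E * (\sum_(0 <= i < n) mu (F i)) +
              t%:E * (\sum_(0 <= i < n) nu (F i)))); last first.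
  by apply/funext => n; rewrite big_split !ge0_sume_distrr.
apply: cvgeD.
- by apply: ge0_adde_def; rewrite inE; apply: mule_ge0; rewrite ?lee_fin.
- by apply: cvgeZl => //; exact: measure_semi_sigma_additive.
- by apply: cvgeZl => //; exact: measure_semi_sigma_additive.
Qed.

HB.instance Definition _ := isMeasure.Build _ _ _ mixture
  mixture0 mixture_ge0 mixture_sigma_additive.

Let mixture_setT : mixture setT = 1.
Proof.
rewrite /mixture !probability_setT; case: ifPn => // _.
by rewrite !mule1 -EFinD subrK.
Qed.

HB.instance Definition _ :=
  Measure_isProbability.Build _ _ _ mixture mixture_setT.

End mixture.

Section functionals.
Context d (T : measurableType d) (R : realType).
Implicit Types (J : probability T R -> R) (mu nu : probability T R).

(* Two terms of type probability T R may agree on all measurable sets and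
   still differ on nonmeasurable ones; a function on the set of probability
   measures must not see the difference. *)
Definition well_defined J := forall mu nu,
  (forall A, measurable A -> mu A = nu A) -> J mu = J nu.

Definition convex_functional J := forall mu nu (t : R), 0 <= t <= 1 ->
  J (mixture t mu nu) <= (1 - t) * J mu + t * J nu.

Definition difference_quotient J mu nu (t : R) : R :=
  t^-1 * (J (mixture t mu nu) - J mu).

Definition directional_derivative J mu nu : R :=
  lim (difference_quotient J mu nu t @[t --> 0^'+]).

Definition influence J mu (x : T) : R := directional_derivative J mu \d_x.

Definition has_von_mises_derivative J mu :=
  (forall nu, cvg (difference_quotient J mu nu t @[t --> 0^'+])) /\
  exists phi : T -> R,
    [/\ measurable_fun setT phi,
        (forall nu, nu.-integrable setT (EFin \o phi)) &
        forall nu, directional_derivative J mu nu =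
          \int[nu]_x phi x - \int[mu]_x phi x].

Definition tv_dist mu nu : R :=
  sup [set `|fine (mu A) - fine (nu A)| | A in measurable].

Definition tv_diameter : R :=
  sup [set r | exists mu nu, r = tv_dist mu nu].

Definition sup_norm (g : T -> R) : \bar R :=
  ereal_sup [set `|g x|%:E | x in setT].

Definition smooth_functional J (L : R) := forall mu1 mu2,
  (sup_norm (fun x => influence J mu1 x - influence J mu2 x)%R
     <= (L * tv_dist mu1 mu2)%:E)%E.

End functionals.

Arguments tv_diameter {d} T R.

Section sampling.
Context dT (T : measurableType dT) dS (S : measurableType dS) (R : realType).

Definition oracle_mean (H : probability T R -> T -> S -> R)
    (mu : probability T R) (m : nat) (y : m.-tuple S) (x : T) : R :=
  m%:R^-1 * \sum_(j < m) H mu x (tnth y j).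

Context dO (Omega : measurableType dO) (P : probability Omega R).

(* The m coordinates of Z are independent, each with the law of Y. *)
Definition iid_copies (Y : {RV P >-> S}) (m : nat)
    (Z : {RV P >-> m.-tuple S}) :=
  forall B : 'I_m -> set S, (forall j, measurable (B j)) ->
    P [set w | forall j, B j (tnth (Z w) j)] =
    (\prod_(j < m) distribution P Y (B j))%E.

Definition measurable_wrt (F : set (set Omega)) d' (U : measurableType d')
    (Z : Omega -> U) := forall A, measurable A -> F (Z @^-1` A).

Definition independent_of (F : set (set Omega)) d' (U : measurableType d')
    (Z : Omega -> U) :=
  forall E A, F E -> measurable A ->
    P (E `&` Z @^-1` A) = (P E * P (Z @^-1` A))%E.

Definition is_filtration (F : nat -> set (set Omega)) :=
  [/\ forall k, sigma_algebra setT (F k),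
      forall k, F k `<=` measurable &
      forall k, F k `<=` F k.+1].

End sampling.

Definition fw_step (R : realType) (k : nat) : R := 2 / (k%:R + 2).

(* The atom added when passing from step k to step k + 1 is xhat k.+1;
   xhat 0 is not used. *)
Fixpoint fw_iterate d (T : measurableType d) (R : realType) (Omega : Type)
    (mu0 : probability T R) (xhat : nat -> Omega -> T) (k : nat) (w : Omega) :
    probability T R :=
  if k is k'.+1 then
    mixture (fw_step R k') (fw_iterate mu0 xhat k' w) \d_(xhat k w)
  else mu0.

(* Main.v *)
(* A positive total variation diameter equals 1, and the influence function,
   which vanishes at x for the Dirac mass at x, is bounded by L. Along the segment
   from mu to the Dirac mass at x the slope of J at time t is
   h_(mu_t)(x) / (1 - t) <= (h_mu(x) + L t) / (1 - t); integrating gives a descent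
   inequality with curvature term L eta^2 / 2 to leading order, half of what the
   bound |int f d(nu - mu)| <= 2 |f| TV would give. For the sampling error,
   E h(xhat) <= E H(xhat) + E eps <= E H(x) + E eps = E h(x) + E eps for each fixed
   x, where eps = |H - h| and the last step is unbiasedness together with the
   independence of the batch from mu_k; hence eps is paid only once. Averaging x
   over mu* and using convexity, the expected gap a_k satisfies
   a_(k+1) <= a_k + (eta + r) (- a_k + L / (k + 3)) + r L with
   r = 2 / (k (k + 2)), which preserves a_k <= 4 L / (k + 2) for k >= 2, while
   a_k <= L settles k = 1, 2. *)

From HB Require Import structures.
Require Import Defs.
From mathcomp Require Import all_boot all_order all_algebra.
From mathcomp Require Import all_classical all_reals all_analysis.
From mathcomp Require Import measurable_realfun.
From mathcomp Require Import ring lra.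

Set Implicit Arguments.
Unset Strict Implicit.
Unset Printing Implicit Defensive.

Import Order.TTheory GRing.Theory Num.Theory.
Import numFieldNormedType.Exports.

Local Open Scope classical_set_scope.
Local Open Scope ring_scope.

(** * Two inequalities over the reals: integrating a slope bound, and the rate recursion *)

(** The bound at right endpoints plays the role of a derivative bound [p + q t]. Summed over [n]
    equal pieces it gives a Riemann sum that differs from the integral [p eta + q eta^2 / 2] by
    [q eta^2 / (2 n)], which vanishes as [n] grows. *)
Lemma quadratic_growth (R : realType) (g : R -> R) (eta p q : R) : 0 < eta ->
  (forall a b, 0 <= a -> a < b -> b <= eta ->
     g b - g a <= (b - a) * (p + q * b)) ->
  g eta - g 0 <= p * eta + q * eta ^+ 2 / 2.
Proof.
move=> eta0 gP; apply/ler_addgt0Pr => e e0.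
(* This choice makes [q eta^2 / (2 n) <= e]; the successor keeps [n] positive. *)
pose n := (Num.bound (`|q| * eta ^+ 2 / (2 * e))).+1.
have n0 : 0 < n%:R :> R by rewrite ltr0n.
pose s := eta / n%:R.
have s0 : 0 < s by rewrite divr_gt0.
have sn : s * n%:R = eta by rewrite /s divfK// gt_eqF.
have ind (i : nat) : (i <= n)%N -> g (s * i%:R) - g 0 <=
    p * (s * i%:R) + q * s ^+ 2 * (i%:R * (i%:R + 1)) / 2.
  elim: i => [_|i IH lin]; first by rewrite mulr0 subrr; lra.
  have ssucc : s * i.+1%:R = s * i%:R + s by rewrite -natr1; ring.
  have := gP (s * i%:R) (s * i.+1%:R).
  have -> : s * i.+1%:R <= eta by rewrite -sn ler_pM2l// ler_nat.
  have -> : s * i%:R < s * i.+1%:R by rewrite ltr_pM2l// ltr_nat.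
  rewrite mulr_ge0 ?(ltW s0)// => /(_ isT isT isT).
  move: (IH (ltnW lin)); rewrite ssucc -natr1.
  move=> h1 h2; rewrite -[leLHS](subrKA (g (s * i%:R))).
  apply: (le_trans (lerD h2 h1)); rewrite le_eqVlt; apply/orP; left; apply/eqP.
  by field.
have := ind n (leqnn n); rewrite sn => /le_trans; apply.
have -> : q * s ^+ 2 * (n%:R * (n%:R + 1)) / 2 =
    q * eta ^+ 2 / 2 + q * eta ^+ 2 / (2 * n%:R).
  by rewrite /s; field; rewrite gt_eqF.
suff : q * eta ^+ 2 / (2 * n%:R) <= e by lra.
rewrite ler_pdivrMr ?mulr_gt0//.
have := archi_boundP (x := `|q| * eta ^+ 2 / (2 * e)).
have -> : 0 <= `|q| * eta ^+ 2 / (2 * e).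
  by rewrite divr_ge0// ?mulr_ge0// ltW.
move=> /(_ isT).
rewrite ltr_pdivrMr ?mulr_gt0// => hb.
apply: (@le_trans _ _ (`|q| * eta ^+ 2)).
  by rewrite ler_wpM2r ?sqr_ge0// ler_norm.
apply: (le_trans (ltW hb)).
rewrite /n -natr1; nra.
Qed.

(** The left side is affine in [a] with slope [(k^2 - 2) / (k (k + 2))], which is nonnegative from
    [k = 2] on but negative at [k = 1]. So the worst case is [a = 4 L / (k + 2)], where the slack is
    [8 L (k + 1) / (k (k + 2)^2 (k + 3))]. *)
Lemma fw_rate_step (R : realType) (L a : R) (k : nat) : 0 < L -> (1 < k)%N ->
  a <= 4 * L / (k%:R + 2) ->
  a + (fw_step R k + 2 / (k%:R * (k%:R + 2))) * (- a + L / (k%:R + 3))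
    + 2 / (k%:R * (k%:R + 2)) * L <= 4 * L / (k%:R + 3).
Proof.
move=> L0 k1; rewrite /fw_step.
have : 2 <= k%:R :> R by rewrite ler_nat.
move: (k%:R) => x x2 hA.
have x0 : 0 < x by lra.
rewrite -subr_ge0.
pose b := 4 * L / (x + 2).
have c0 : 0 <= 1 - 2 / (x + 2) - 2 / (x * (x + 2)).
  have -> : 1 - 2 / (x + 2) - 2 / (x * (x + 2)) = (x ^+ 2 - 2) / (x * (x + 2)).
    by field; apply/andP; split; lra.
  by apply: divr_ge0; nra.
have ba0 : 0 <= b - a by rewrite subr_ge0.
have := mulr_ge0 c0 ba0.
have : 4 * L / (x + 3) - (b + (2 / (x + 2) + 2 / (x * (x + 2))) * (- b + L / (x + 3))
  + 2 / (x * (x + 2)) * L) = L * (8 * x + 8) / (x * (x + 2) ^+ 2 * (x + 3)).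
  by rewrite /b; field; apply/and3P; split; lra.
have : 0 <= L * (8 * x + 8) / (x * (x + 2) ^+ 2 * (x + 3)).
  by rewrite divr_ge0 ?mulr_ge0 ?exprn_ge0//; lra.
move: (L * (8 * x + 8) / _) => y.
nra.
Qed.

(** * Mixtures and total variation *)

Section mixture_facts.
Context d (T : measurableType d) (R : realType).
Implicit Types (mu nu : probability T R) (A : set T).

Lemma fine_probability mu A : measurable A -> mu A = (fine (mu A))%:E.
Proof. by move=> mA; rewrite fineK// fin_num_measure. Qed.

Lemma mixtureE (t : R) mu nu A : 0 <= t <= 1 ->
  mixture t mu nu A = ((1 - t)%:E * mu A + t%:E * nu A)%E.
Proof. by move=> t01; rewrite /= /mixture t01. Qed.

Lemma fine_mixture (t : R) mu nu A : 0 <= t <= 1 -> measurable A ->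
  fine (mixture t mu nu A) = (1 - t) * fine (mu A) + t * fine (nu A).
Proof.
move=> t01 mA; rewrite mixtureE// (fine_probability mu)// (fine_probability nu)//.
Qed.

Lemma mixture_mixture (t a b : R) mu nu A :
  0 <= t <= 1 -> 0 <= a <= 1 -> 0 <= b <= 1 -> measurable A ->
  mixture t (mixture a mu nu) (mixture b mu nu) A =
  mixture ((1 - t) * a + t * b) mu nu A.
Proof.
move=> t01 a01 b01 mA.
have ab01 : 0 <= (1 - t) * a + t * b <= 1 by apply/andP; split; nra.
rewrite [LHS]fine_probability// [RHS]fine_probability//; congr EFin.
by rewrite !fine_mixture//; ring.
Qed.

Lemma mixture0 mu nu A : mixture 0 mu nu A = mu A.
Proof. by rewrite mixtureE ?lexx ?ler01// subr0 mul1e mul0e adde0. Qed.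

Lemma mixture_id (t : R) mu A : measurable A -> mixture t mu mu A = mu A.
Proof.
move=> mA; have [t01|t01] := boolP (0 <= t <= 1); last first.
  by rewrite /= /mixture (negbTE t01).
rewrite [LHS]fine_probability// [RHS]fine_probability//; congr EFin.
by rewrite fine_mixture//; ring.
Qed.

Lemma normr_prob_sub mu nu A : measurable A -> `|fine (mu A) - fine (nu A)| <= 1.
Proof.
move=> mA; have := probability_le1 mu mA; have := probability_le1 nu mA.
rewrite (fine_probability mu)// (fine_probability nu)// !lee_fin => *.
have := fine_ge0 (measure_ge0 mu A); have := fine_ge0 (measure_ge0 nu A) => *.
by rewrite ler_norml; apply/andP; split; lra.
Qed.

Lemma ge_tv_dist mu nu (c : R) :
  (forall A, measurable A -> `|fine (mu A) - fine (nu A)| <= c) ->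
  tv_dist mu nu <= c.
Proof.
move=> h; apply: ge_sup; last by move=> _ [A mA <-]; exact: h.
by exists `|fine (mu set0) - fine (nu set0)|, set0.
Qed.

Lemma le_tv_dist mu nu A : measurable A ->
  `|fine (mu A) - fine (nu A)| <= tv_dist mu nu.
Proof.
move=> mA; apply: ub_le_sup; last by exists A.
by exists 1 => _ [B mB <-]; exact: normr_prob_sub.
Qed.

Lemma tv_dist_le1 mu nu : tv_dist mu nu <= 1.
Proof. by apply: ge_tv_dist => A mA; exact: normr_prob_sub. Qed.

Lemma tv_dist_mixture (t : R) mu nu : 0 <= t <= 1 ->
  tv_dist (mixture t mu nu) mu <= t.
Proof.
move=> t01; have [t0 _] := andP t01; apply: ge_tv_dist => A mA.
rewrite fine_mixture//.
have -> : (1 - t) * fine (mu A) + t * fine (nu A) - fine (mu A) =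
  t * (fine (nu A) - fine (mu A)) by ring.
by rewrite normrM ger0_norm// ler_piMr// normr_prob_sub.
Qed.

(* The diameter, being positive, is attained by two Dirac masses: a measurable
   set on which two probabilities differ is neither empty nor full. *)
Lemma tv_diameter_eq1 : 0 < tv_diameter T R -> tv_diameter T R = 1.
Proof.
move=> D0.
have ub1 : ubound [set r : R | exists mu nu : probability T R, r = tv_dist mu nu] 1.
  by move=> _ [mu [nu ->]]; exact: tv_dist_le1.
have ne : [set r : R | exists mu nu : probability T R, r = tv_dist mu nu] !=set0.
  by exists (tv_dist (\d_(@point T) : probability T R) \d_(@point T)),
    \d_(@point T), \d_(@point T).
apply/eqP; rewrite eq_le; apply/andP; split.
  exact: ge_sup.
have [x [y [A [mA [Ax nAy]]]]] : exists x y : T, exists A : set T,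
    measurable A /\ A x /\ ~ A y.
  apply: contrapT => h.
  have : tv_diameter T R <= 0.
    apply: ge_sup => // _ [mu [nu ->]]; apply: ge_tv_dist => A mA.
    have [->|/set0P[x Ax]] := eqVneq A set0; first by rewrite !measure0 subrr normr0.
    have -> : A = setT.
      apply/seteqP; split => // y _; apply: contrapT => nAy.
      by apply: h; exists x, y, A.
    by rewrite !probability_setT subrr normr0.
  by rewrite leNgt D0.
apply: (@le_trans _ _ (tv_dist (\d_x : probability T R) \d_y)); last first.
  apply: ub_le_sup; first by exists 1.
  by exists (\d_x : probability T R), (\d_y : probability T R).
apply: le_trans (le_tv_dist _ _ mA).
by rewrite /= /dirac !indicE mem_set// memNset//= subr0 normr1.
Qed.

End mixture_facts.

(** * Influence functions of a smooth convex functional *)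

Section influence_facts.
Context d (T : measurableType d) (R : realType).
Implicit Types (J : probability T R -> R) (mu nu : probability T R).

Lemma Rintegral_probability_cst mu (c : R) : \int[mu]_x c = c.
Proof.
rewrite Rintegral_cst//.
by have -> : fine (mu setT) = 1; rewrite ?mulr1// probability_setT.
Qed.

(** The limit is one-sided at 0, so a bound for [t] in (0, 1) suffices, and there [mixture] is a
    true convex combination. *)
Lemma directional_derivative_le J mu nu (c : R) :
  has_von_mises_derivative J mu ->
  (forall t : R, 0 < t < 1 -> difference_quotient J mu nu t <= c) ->
  directional_derivative J mu nu <= c.
Proof.
move=> [cv _] h; apply: limr_le; first exact: cv.
near=> t; apply: h; apply/andP; split; near: t.
  exact: nbhs_right_gt.
exact: nbhs_right_lt.
Unshelve. all: by end_near. Qed.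

Lemma directional_derivative_ge J mu nu (c : R) :
  has_von_mises_derivative J mu ->
  (forall t : R, 0 < t < 1 -> c <= difference_quotient J mu nu t) ->
  c <= directional_derivative J mu nu.
Proof.
move=> [cv _] h; apply: limr_ge; first exact: cv.
near=> t; apply: h; apply/andP; split; near: t.
  exact: nbhs_right_gt.
exact: nbhs_right_lt.
Unshelve. all: by end_near. Qed.

(** Taking [nu = \d_x] turns the integral of [phi] into [phi x], so the influence function is [phi]
    centred under [mu]. *)
Lemma influenceE J mu : has_von_mises_derivative J mu ->
  exists phi : T -> R, [/\ measurable_fun setT phi,
    forall nu, nu.-integrable setT (EFin \o phi),
    forall x, influence J mu x = phi x - \int[mu]_x phi x &
    forall nu, directional_derivative J mu nu =
      \int[nu]_x phi x - \int[mu]_x phi x].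
Proof.
move=> [_ [phi [mphi iphi dphi]]]; exists phi; split => // x.
rewrite /influence dphi; congr (_ - _).
rewrite /Rintegral integral_dirac//; first by rewrite diracT mul1e.
exact/measurable_EFinP.
Qed.

Lemma integrable_influence J mu nu : has_von_mises_derivative J mu ->
  nu.-integrable setT (EFin \o influence J mu).
Proof.
move=> /influenceE[phi [_ iphi hE _]].
rewrite (funext hE); exact: (integrableB measurableT (iphi nu)
  (finite_measure_integrable_cst nu (\int[mu]_x phi x) measurableT)).
Qed.

Lemma directional_derivativeE J mu nu : has_von_mises_derivative J mu ->
  directional_derivative J mu nu = \int[nu]_x influence J mu x.
Proof.
move=> /influenceE[phi [_ iphi hE ->]].
rewrite (funext hE) RintegralB ?Rintegral_probability_cst//.
  exact: iphi.
exact: finite_measure_integrable_cst.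
Qed.

(** Mixing a Dirac mass with itself changes nothing, so every difference quotient is zero. This
    anchors the uniform bound on influence functions. *)
Lemma influence_dirac J x : well_defined J ->
  has_von_mises_derivative J \d_x -> influence J \d_x x = 0.
Proof.
move=> Jwd vm.
have q0 t : difference_quotient J \d_x \d_x t = 0.
  rewrite /difference_quotient (_ : J (mixture _ _ _) = J \d_x) ?subrr ?mulr0//.
  by apply: Jwd => A mA; exact: mixture_id.
apply/eqP; rewrite eq_le; apply/andP; split.
  by apply: directional_derivative_le => // t _; rewrite q0.
by apply: directional_derivative_ge => // t _; rewrite q0.
Qed.

Lemma smooth_influence_le J L mu nu x : 0 < L -> smooth_functional J L ->
  `|influence J mu x - influence J nu x| <= L * tv_dist mu nu.
Proof.
move=> L0 /(_ mu nu) h; rewrite -lee_fin; apply: le_trans h.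
by apply: ereal_sup_ubound; exists x.
Qed.

(** Compare [mu] with the Dirac mass at the same [x], where the influence vanishes; their distance
    is at most 1. *)
Lemma normr_influence_le J L mu x : well_defined J ->
  (forall mu, has_von_mises_derivative J mu) -> 0 < L ->
  smooth_functional J L -> `|influence J mu x| <= L.
Proof.
move=> Jwd vm L0 Jsm; have := smooth_influence_le mu \d_x x L0 Jsm.
rewrite influence_dirac// subr0 => /le_trans; apply.
by rewrite ler_piMr ?tv_dist_le1// ltW.
Qed.

Lemma convex_directional_derivative_le J mu nu : convex_functional J ->
  has_von_mises_derivative J mu ->
  directional_derivative J mu nu <= J nu - J mu.
Proof.
move=> Jcv vm; apply: directional_derivative_le => // t /andP[t0 t1].
have /(Jcv mu nu) : 0 <= t <= 1 by rewrite !ltW.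
by rewrite /difference_quotient ler_pdivrMl// => ?; lra.
Qed.

(** By convexity the gap is at most minus the derivative towards [nu], that is, minus the
    [nu]-average of an influence function with values at least [- L]. *)
Lemma convex_gap_le J L mu nu : well_defined J -> convex_functional J ->
  (forall mu, has_von_mises_derivative J mu) -> 0 < L ->
  smooth_functional J L -> J mu - J nu <= L.
Proof.
move=> Jwd Jcv vm L0 Jsm.
have := convex_directional_derivative_le nu Jcv (vm mu).
rewrite directional_derivativeE//.
suff : - L <= \int[nu]_x influence J mu x by lra.
have -> : - L = \int[nu]_x (cst (- L) x) by rewrite Rintegral_probability_cst.
apply: le_Rintegral => //.
- exact: finite_measure_integrable_cst.
- exact: integrable_influence.
- move=> x _ /=; have := normr_influence_le mu x Jwd vm L0 Jsm.
  by rewrite ler_norml => /andP[].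
Qed.

(* The slope of the convex function t |-> J (mixture t mu \d_x) on [a, b] is at
   most its right derivative at b, which is influence J mu_b x / (1 - b). *)
Lemma convex_chord_le J mu x (a b : R) : well_defined J ->
  convex_functional J -> (forall mu, has_von_mises_derivative J mu) ->
  0 <= a -> a < b -> b < 1 ->
  (1 - b) * (J (mixture b mu \d_x) - J (mixture a mu \d_x)) <=
  (b - a) * influence J (mixture b mu \d_x) x.
Proof.
move=> Jwd Jcv vm a0 ab b1.
have ba0 : 0 < b - a by rewrite subr_gt0.
rewrite -ler_pdivrMl//; apply: directional_derivative_ge => // s /andP[s0 s1].
(* Moving from time [b] a fraction [s] of the way to [\d_x] reaches time [b'] on the same segment;
   this change of parameter produces the factor [1 - b]. *)
pose b' := b + s * (1 - b).
have -> : difference_quotient J (mixture b mu \d_x) \d_x s =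
    s^-1 * (J (mixture b' mu \d_x) - J (mixture b mu \d_x)).
  congr (_ * (_ - _)); apply: Jwd => A mA.
  rewrite [LHS]fine_probability// [RHS]fine_probability//; congr EFin.
  by rewrite !fine_mixture//; [rewrite /b'; ring|..]; apply/andP; split;
    rewrite /b'; nra.
have bb' : b < b' by rewrite /b'; nra.
have b'1 : b' < 1 by rewrite /b'; nra.
(* The weight that writes [b] as a combination of [a] and [b']; convexity then compares the slopes
   on [[a, b]] and [[b, b']]. *)
pose w := (b - a) / (b' - a).
have w01 : 0 <= w <= 1.
  by rewrite divr_ge0 ?ler_pdivrMr ?subr_gt0//=; lra.
have := Jcv (mixture a mu \d_x) (mixture b' mu \d_x) w w01.
have -> : J (mixture w (mixture a mu \d_x) (mixture b' mu \d_x)) =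
    J (mixture b mu \d_x).
  apply: Jwd => A mA; rewrite [LHS]mixture_mixture//; try by apply/andP; split; lra.
  by have -> : (1 - w) * a + w * b' = b by rewrite /w; field; lra.
set x1 := J (mixture b mu _); set x2 := J (mixture b' mu _).
set x3 := J (mixture a mu _) => h.
have b'a0 : 0 < b' - a by lra.
rewrite ler_pdivlMl// mulrCA ler_pdivrMl//.
have : (b' - a) * x1 <= (b' - a) * ((1 - w) * x3 + w * x2).
  by rewrite ler_pM2l//; lra.
have -> : (b' - a) * ((1 - w) * x3 + w * x2) = (b' - b) * x3 + (b - a) * x2.
  by rewrite /w; field; lra.
rewrite /b'; nra.
Qed.

(* The slope (h + L t) / (1 - t) at time t is convex in t because h >= - L, so it
   lies below an affine function on [0, eta]. *)
Lemma fw_descent J L mu x (eta : R) : well_defined J ->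
  convex_functional J -> (forall mu, has_von_mises_derivative J mu) ->
  0 < L -> smooth_functional J L -> 0 < eta -> eta < 1 ->
  J (mixture eta mu \d_x) <= J mu + eta * influence J mu x +
    (L + influence J mu x) * (eta ^+ 2 / (2 * (1 - eta))).
Proof.
move=> Jwd Jcv vm L0 Jsm eta0 eta1; pose h := influence J mu x.
have hL : 0 <= L + h.
  have := normr_influence_le mu x Jwd vm L0 Jsm.
  by rewrite ler_norml -/h => /andP[]; lra.
(* The slope [(h + L t) / (1 - t)] equals [h + (L + h) t / (1 - t)]; replacing [1 - t] by [1 - eta]
   gives the affine bound with these coefficients. *)
have := @quadratic_growth R (fun t => J (mixture t mu \d_x)) eta h
  ((L + h) / (1 - eta)) eta0.
have J0 : J (mixture 0 mu \d_x) = J mu by apply: Jwd => A mA; exact: mixture0.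
rewrite J0.
rewrite -/h => qg; have -> :
  (L + h) * (eta ^+ 2 / (2 * (1 - eta))) =
  (L + h) / (1 - eta) * eta ^+ 2 / 2 by field; lra.
suff : forall a b : R, 0 <= a -> a < b -> b <= eta ->
  J (mixture b mu \d_x) - J (mixture a mu \d_x) <=
    (b - a) * (h + (L + h) / (1 - eta) * b).
  by move=> /qg; rewrite lerBlDl addrA (mulrC h).
move=> a b a0 ab beta.
have b1 : 0 < 1 - b by lra.
have b1' : b < 1 by lra.
rewrite -(ler_pM2l b1); apply: (le_trans (convex_chord_le mu x Jwd Jcv vm a0 ab b1')).
rewrite mulrCA ler_pM2l ?subr_gt0//.
have hb : influence J (mixture b mu \d_x) x <= h + L * b.
  have := smooth_influence_le (mixture b mu \d_x) mu x L0 Jsm.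
  move=> /(le_trans (ler_norm _)) /le_trans.
  move=> /(_ (L * b)); rewrite ler_pM2l// tv_dist_mixture; last by apply/andP; split; lra.
  by move=> /(_ isT); rewrite -/h; lra.
apply: (le_trans hb).
(* This is exactly the amount by which the affine bound, multiplied by [1 - b], exceeds
   [h + L b]. *)
have e1 : 0 <= (L + h) * b * ((1 - b) / (1 - eta) - 1).
  apply: mulr_ge0; first by apply: mulr_ge0; lra.
  by rewrite subr_ge0 ler_pdivlMr; lra.
suff -> : (1 - b) * (h + (L + h) / (1 - eta) * b) =
  h + L * b + (L + h) * b * ((1 - b) / (1 - eta) - 1) by lra.
by field; lra.
Qed.

End influence_facts.

(** * Integrals of independent and identically distributed variables *)

Section integration_facts.
Local Open Scope ereal_scope.

Lemma bounded_integrable d (T : measurableType d) (R : realType)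
    (mu : {finite_measure set T -> \bar R}) (f : T -> R) (c : R) :
  measurable_fun setT f -> (forall x, `|f x| <= c)%R ->
  mu.-integrable setT (EFin \o f).
Proof.
move=> mf fc; apply: (le_integrable measurableT _ _
  (finite_measure_integrable_cst mu c measurableT)); first exact/measurable_EFinP.
by move=> x _ /=; rewrite lee_fin (le_trans (fc x))// ler_norm.
Qed.

Lemma integral_comp_funeposneg d (T : measurableType d) (R : realType) (V : Type)
    (mu : {measure set T -> \bar R}) (f : V -> \bar R) (h : T -> V) :
  \int[mu]_x f (h x) = \int[mu]_x f^\+ (h x) - \int[mu]_x f^\- (h x).
Proof.
by rewrite -[LHS]/(\int[mu]_x (f \o h) x) integralE funepos_comp funeneg_comp.
Qed.

(** Tonelli is applied to the positive and negative parts separately, since [f] may take both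
    signs. *)
Lemma measurable_partial_integral dA (A : measurableType dA) dO
    (Omega : measurableType dO) (R : realType) (P : probability Omega R)
    (f : A * Omega -> \bar R) :
  measurable_fun setT f -> measurable_fun setT (fun a => \int[P]_w f (a, w)).
Proof.
move=> mf.
have -> : (fun a => \int[P]_w f (a, w)) =
    (fubini_F P (f^\+) \- fubini_F P (f^\-)).
  by apply/funext => a; rewrite (integral_comp_funeposneg P f (pair a)).
apply: emeasurable_funB.
  exact: (measurable_fun_fubini_tonelli_F _ (measurable_funepos mf)).
exact: (measurable_fun_fubini_tonelli_F _ (measurable_funeneg mf)).
Qed.

Lemma product_probability_setT dU (U : measurableType dU) dV
    (V : measurableType dV) (R : realType) (P : probability U R)
    (Q : probability V R) : (P \x Q) setT = 1.
Proof.
rewrite -setXTT product_measure1E// -[RHS]mule1.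
by congr (_ * _); exact: probability_setT.
Qed.

(** A bounded function is integrable for a product of probabilities, so Fubini applies; the inner
    integrals are finite, so taking [fine] inside loses nothing. *)
Lemma bounded_Rintegral_exchange dU (U : measurableType dU) dV
    (V : measurableType dV) (R : realType) (P : probability U R)
    (Q : probability V R) (f : U * V -> R) (c : R) :
  measurable_fun setT f -> (forall z, `|f z| <= c)%R ->
  (\int[P]_u (\int[Q]_v f (u, v)) = \int[Q]_v (\int[P]_u f (u, v)))%R.
Proof.
move=> mf fc.
have If : (P \x Q).-integrable setT (EFin \o f).
  apply: measurable_bounded_integrable => //.
    by rewrite [ltLHS](product_probability_setT P Q) ltry.
  exists c; split; first exact: num_real.
  by move=> M cM x _ /=; rewrite (le_trans (fc x))// ltW.
have := Fubini If; rewrite /Rintegral => FubE.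
congr fine; transitivity (\int[P]_u \int[Q]_v (EFin \o f) (u, v)).
  apply: eq_integral => u _; rewrite fineK//; apply: integrable_fin_num => //.
  by apply: (@bounded_integrable _ _ _ Q (fun v => f (u, v)) c) => //;
    apply: measurableT_comp.
rewrite FubE; apply: eq_integral => v _; rewrite fineK//.
apply: integrable_fin_num => //.
by apply: (@bounded_integrable _ _ _ P (fun u => f (u, v)) c) => //;
  apply: measurableT_comp.
Qed.

Section independence.
Context dO (Omega : measurableType dO) (R : realType)
  (P : probability Omega R) dU (U : measurableType dU) dV
  (V : measurableType dV) (M : {RV P >-> U}) (Z : {RV P >-> V}).
Hypothesis MZ : forall A B, measurable A -> measurable B ->
  P (M @^-1` A `&` Z @^-1` B) = P (M @^-1` A) * P (Z @^-1` B).

(** The law of [(M, Z)] agrees with the product of the two laws on rectangles, hence everywhere.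
    Tonelli then separates the variables, and each is pulled back to [Omega]. *)
Lemma independent_ge0_integral (f : U * V -> \bar R) :
  measurable_fun setT f -> (forall z, 0 <= f z) ->
  \int[P]_w f (M w, Z w) = \int[P]_w \int[P]_w' f (M w, Z w').
Proof.
move=> mf f0.
have mMZ : measurable_fun setT (fun w => (M w, Z w)).
  exact: measurable_fun_pair.
transitivity (\int[pushforward P (fun w => (M w, Z w))]_z f z).
  by rewrite ge0_integral_pushforward.
transitivity (\int[distribution P M \x distribution P Z]_z f z).
  apply: eq_measure_integral => A mA _; symmetry.
  apply: product_measure_unique => // B C mB mC.
rewrite fubini_tonelli1//.
transitivity (\int[distribution P M]_u \int[P]_w' f (u, Z w')).
  apply: eq_integral => u _; rewrite /fubini_F ge0_integral_distribution//.
  exact: measurableT_comp.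
rewrite ge0_integral_distribution//.
- apply: (@measurable_partial_integral _ U _ Omega _ P (fun z => f (z.1, Z z.2))).
  apply: measurableT_comp => //; apply/measurable_fun_pair => //.
  exact: measurableT_comp.
- by move=> u; exact: integral_ge0.
Qed.

(** For each frozen [u] the positive and negative parts have the same integral, so by independence
    their joint integrals agree too. Joint integrability makes these finite, and they cancel. *)
Lemma independent_integral0 (f : U * V -> \bar R) :
  measurable_fun setT f ->
  (forall u, P.-integrable setT (fun w => f (u, Z w))) ->
  (forall u, \int[P]_w f (u, Z w) = 0) ->
  P.-integrable setT (fun w => f (M w, Z w)) ->
  \int[P]_w f (M w, Z w) = 0.
Proof.
move=> mf fi f0 fMZ.
have fpn u : \int[P]_w f^\+ (u, Z w) = \int[P]_w f^\- (u, Z w).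
  have := f0 u; rewrite (integral_comp_funeposneg P f (fun w => (u, Z w))).
  move/eqP; rewrite sube_eq ?add0e => [/eqP//||].
    by have := integrable_pos_fin_num measurableT (fi u); rewrite funepos_comp.
  rewrite fin_num_adde_defl//.
  by have := integrable_neg_fin_num measurableT (fi u); rewrite funeneg_comp.
rewrite (integral_comp_funeposneg P f (fun w => (M w, Z w))).
rewrite independent_ge0_integral//; last exact: measurable_funepos.
rewrite [X in X - _](eq_integral (fun w => \int[P]_w' f^\- (M w, Z w'))); last first.
  by move=> w _; exact: fpn.
rewrite -independent_ge0_integral//; last exact: measurable_funeneg.
rewrite subee//.
by have := integrable_neg_fin_num measurableT fMZ; rewrite funeneg_comp.
Qed.

End independence.

Section same_law.
Context dO (Omega : measurableType dO) (R : realType)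
  (P : probability Omega R) dV (V : measurableType dV) (Y Z : {RV P >-> V}).
Hypothesis YZ : forall A, measurable A -> P (Z @^-1` A) = P (Y @^-1` A).

Lemma same_law_ge0_integral (f : V -> \bar R) : measurable_fun setT f ->
  (forall v, 0 <= f v) -> \int[P]_w f (Z w) = \int[P]_w f (Y w).
Proof.
move=> mf f0.
transitivity (\int[distribution P Z]_v f v).
  by rewrite ge0_integral_distribution.
transitivity (\int[distribution P Y]_v f v).
  by apply: eq_measure_integral => A mA _; exact: YZ.
by rewrite ge0_integral_distribution.
Qed.

Lemma same_law_integral (f : V -> \bar R) : measurable_fun setT f ->
  \int[P]_w f (Z w) = \int[P]_w f (Y w).
Proof.
move=> mf; rewrite !(integral_comp_funeposneg P f); congr (_ - _).
  apply: (@same_law_ge0_integral f^\+) => //; exact: measurable_funepos.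
apply: (@same_law_ge0_integral f^\-) => //; exact: measurable_funeneg.
Qed.

Lemma same_law_integrable (f : V -> \bar R) : measurable_fun setT f ->
  P.-integrable setT (f \o Y) -> P.-integrable setT (f \o Z).
Proof.
move=> mf /integrableP[_ fY]; apply/integrableP; split.
  exact: measurableT_comp.
apply: le_lt_trans fY.
rewrite (@same_law_ge0_integral (abse \o f)) ?lexx//.
  exact: measurableT_comp.
by move=> v; exact: abse_ge0.
Qed.

End same_law.

(* In \bar R, oo - oo = -oo, so a finite integral forces both parts to be
   finite. *)
Lemma fin_num_integral_integrable d (T : measurableType d) (R : realType)
    (mu : {measure set T -> \bar R}) (f : T -> \bar R) :
  measurable_fun setT f -> \int[mu]_x f x \is a fin_num ->
  mu.-integrable setT f.
Proof.
move=> mf; rewrite integralE fin_numB => /andP[fp fn].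
apply/integrableP; split => //.
rewrite -/(abse \o f) fune_abse.
rewrite ge0_integralD//; last 2 first.
- exact: measurable_funepos.
- exact: measurable_funeneg.
by rewrite lte_add_pinfty// ltey_eq ?fp ?fn.
Qed.

End integration_facts.

(** * Stochastic oracle and iterates *)

(** The sigma-algebra on [pprobability] is generated by conditions on the values [mu U], so
    evaluations decide measurability. *)
Lemma measurable_fun_pprobability dA (A : measurableType dA) d
    (T : measurableType d) (R : realType) (g : A -> probability T R) :
  (forall U, measurable U -> measurable_fun setT (fun a => g a U)) ->
  measurable_fun setT (g : A -> pprobability T R).
Proof.
move=> mg; apply: (measurability (@pset _ _ _ : set (set (pprobability T R)))) => //.
move=> _ -[_ [r r01] [U mU <-]] <-.
by apply: emeasurable_fun_infty_o => //; exact: mg.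
Qed.

(** Viewing [G] as the sigma-algebra of a type makes the closure properties of measurable functions
    available for adapted maps. *)
Lemma measurable_wrtP dO (Omega : measurableType dO) (G : set (set Omega)) d
    (U : measurableType d) (Z : Omega -> U) : sigma_algebra setT G ->
  measurable_wrt G Z <->
  measurable_fun setT (Z : g_sigma_algebraType G -> U).
Proof.
move=> sG; have mE (A : set Omega) :
    @measurable _ (g_sigma_algebraType G) A <-> G A.
  by have -> : G A = <<s G>> A by rewrite sigma_algebra_id.
split=> [mZ _ A mA|mZ A mA]; first by rewrite setTI; apply/mE/mZ.
by apply/mE; rewrite -[X in measurable X]setTI; exact: mZ.
Qed.

Lemma measurable_wrt_sub dO (Omega : measurableType dO) (G G' : set (set Omega)) d
    (U : measurableType d) (Z : Omega -> U) :
  G `<=` G' -> measurable_wrt G Z -> measurable_wrt G' Z.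
Proof. by move=> GG' mZ A mA; apply/GG'/mZ. Qed.

Lemma fw_step_itv (R : realType) (k : nat) : 0 <= fw_step R k <= 1.
Proof.
have k0 : 0 <= k%:R :> R by [].
rewrite /fw_step divr_ge0//= ?ler_pdivrMr; lra.
Qed.

(** It suffices to follow the mass of each measurable [U], which obeys an affine recursion driven by
    the Dirac masses at the adapted atoms. *)
Lemma fw_iterate_adapted d (T : measurableType d) (R : realType)
    dO (Omega : measurableType dO) (F : nat -> set (set Omega)) (mu0 : probability T R)
    (xhat : nat -> Omega -> T) :
  (forall k, sigma_algebra setT (F k)) -> (forall k, F k `<=` F k.+1) ->
  (forall k, (0 < k)%N -> measurable_wrt (F k) (xhat k)) ->
  forall k, measurable_wrt (F k)
    (fw_iterate mu0 xhat k : Omega -> pprobability T R).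
Proof.
move=> sF incF mx k.
have meval U : measurable U ->
    measurable_wrt (F k) (fun w => fw_iterate mu0 xhat k w U).
  move=> mU; elim: k => [|k IH]; first exact/measurable_wrtP/measurable_cst.
  have -> : (fun w => fw_iterate mu0 xhat k.+1 w U) = (fun w =>
      (1 - fw_step R k)%:E * fw_iterate mu0 xhat k w U
      + (fw_step R k)%:E * \d_(xhat k.+1 w) U)%E.
    by apply/funext => w; rewrite [LHS]mixtureE ?fw_step_itv.
  apply/measurable_wrtP => //; apply: emeasurable_funD.
    apply: measurable_funeM; apply/measurable_wrtP => //.
    exact: measurable_wrt_sub (incF k) IH.
  apply: measurable_funeM.
  apply: (measurableT_comp (measurable_fun_dirac mU)).
  by apply/measurable_wrtP => //; exact: mx.
apply/measurable_wrtP => //; apply: measurable_fun_pprobability => U mU.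
by apply/measurable_wrtP => //; exact: meval.
Qed.

Section oracle.
Context d (T : measurableType d) dS (S : measurableType dS) (R : realType)
  dO (Omega : measurableType dO) (P : probability Omega R) (Y : {RV P >-> S})
  (J : probability T R -> R) (H : probability T R -> T -> S -> R)
  (H_measurable : measurable_fun setT
     (fun z : pprobability T R * T * S => H z.1.1 z.1.2 z.2))
  (H_unbiased : forall mu x,
     ('E_P[fun w => H mu x (Y w)] = (influence J mu x)%:E)%E).

(** Joint measurability is inherited from the oracle: unbiasedness writes the influence as a partial
    integral of [H]. *)
Lemma measurable_influence2 :
  measurable_fun setT (fun z : pprobability T R * T => influence J z.1 z.2).
Proof.
have -> : (fun z : pprobability T R * T => influence J z.1 z.2) =
    fine \o (fun z => \int[P]_w (H z.1 z.2 (Y w))%:E)%E.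
  by apply/funext => z /=; rewrite -[RHS]/(fine (\int[P]_w _)%E);
    have := H_unbiased z.1 z.2; rewrite unlock => ->.
apply: measurableT_comp => //.
apply: (@measurable_partial_integral _ (pprobability T R * T)%type _ Omega R P
  (fun z => (H z.1.1 z.1.2 (Y z.2))%:E)).
apply/measurable_EFinP.
apply: (measurableT_comp H_measurable (g := fun z => (z.1, Y z.2))).
apply: measurable_fun_pair => //.
exact: measurableT_comp.
Qed.

(** Unbiasedness makes the expectation finite, and this already forces integrability. *)
Lemma oracle_integral mu x :
  P.-integrable setT (fun w => (H mu x (Y w))%:E) /\
  (\int[P]_w (H mu x (Y w))%:E = (influence J mu x)%:E)%E.
Proof.
have := H_unbiased mu x; rewrite unlock => e; split=> //.
apply: fin_num_integral_integrable; last by rewrite e.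
apply/measurable_EFinP.
by apply: (measurableT_comp H_measurable (g := fun w => (mu : pprobability T R, x, Y w)));
  do !apply: measurable_fun_pair.
Qed.

Section batch.
Context (n : nat) (n0 : (0 < n)%N) (Z : {RV P >-> n.-tuple S})
  (Ziid : iid_copies Y Z).

Lemma iid_copies_law (j : 'I_n) (A : set S) : measurable A ->
  P [set w | A (tnth (Z w) j)] = P (Y @^-1` A).
Proof.
(* Only coordinate [j] is constrained, so the other factors of the product are 1. *)
move=> mA; pose B (i : 'I_n) := if i == j then A else setT.
have mB i : measurable (B i) by rewrite /B; case: ifP.
transitivity (P [set w | forall i, B i (tnth (Z w) i)]).
  congr (P _); apply/seteqP; split => w /=.
    by move=> Aw i; rewrite /B; case: ifPn => // /eqP->.
  by move=> /(_ j); rewrite /B eqxx.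
rewrite (Ziid mB) (bigD1 j)//= big1 ?mule1 => [|i ij]; first by rewrite /B eqxx.
by rewrite /B (negbTE ij) probability_setT.
Qed.

Lemma measurable_oracle_mean x : measurable_fun setT
  (fun z : pprobability T R * n.-tuple S => oracle_mean H z.1 z.2 x).
Proof.
apply: measurable_funM => //; apply: measurable_sum => j.
apply: (measurableT_comp H_measurable
  (g := fun z : pprobability T R * n.-tuple S => (z.1, x, tnth z.2 j))).
do !apply: measurable_fun_pair => //.
exact: (measurableT_comp (measurable_tnth j)).
Qed.

(** Every coordinate of the batch has the law of [Y], so unbiasedness passes to the mean by
    linearity. *)
Lemma oracle_mean_integral mu x :
  P.-integrable setT (fun w => (oracle_mean H mu (Z w) x)%:E) /\
  (\int[P]_w (oracle_mean H mu (Z w) x)%:E = (influence J mu x)%:E)%E.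
Proof.
have [iY eY] := oracle_integral mu x.
have mH : measurable_fun setT (fun s => (H mu x s)%:E).
  apply/measurable_EFinP.
  by apply: (measurableT_comp H_measurable (g := fun s => (mu : pprobability T R, x, s)));
    do !apply: measurable_fun_pair.
have mZ (j : 'I_n) : measurable_fun setT (fun w => tnth (Z w) j).
  exact: (measurableT_comp (measurable_tnth j)).
pose Zj (j : 'I_n) : {RV P >-> S} := HB.pack (fun w => tnth (Z w) j)
  (isMeasurableFun.Build _ _ _ _ _ (mZ j)).
have law j A : measurable A -> P (Zj j @^-1` A) = P (Y @^-1` A).
  exact: iid_copies_law.
have iZ j : P.-integrable setT (fun w => (H mu x (tnth (Z w) j))%:E).
  exact: (same_law_integrable (law j) mH iY).
have eZ j : (\int[P]_w (H mu x (tnth (Z w) j))%:E = (influence J mu x)%:E)%E.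
  by rewrite -eY; exact: (same_law_integral (law j) mH).
have e : (fun w => (oracle_mean H mu (Z w) x)%:E) =
    (fun w => (n%:R^-1)%:E * \sum_(j <- index_enum 'I_n)
       (H mu x (tnth (Z w) j))%:E)%E.
  by apply/funext => w; rewrite /oracle_mean EFinM sumEFin.
have iS : P.-integrable setT (fun w => \sum_(j <- index_enum 'I_n)
    (H mu x (tnth (Z w) j))%:E)%E.
  exact: integrable_sum.
rewrite e; split; first exact: integrableZl.
rewrite integralZl// integral_sum//.
under eq_bigr do rewrite eZ.
rewrite sumEFin -EFinM sumr_const card_ord -[influence _ _ _ *+ n]mulr_natl mulKf//.
by rewrite pnatr_eq0 -lt0n.
Qed.

End batch.
End oracle.

Lemma integral_probability_cst d (T : measurableType d) (R : realType)
    (mu : probability T R) (c : R) : (\int[mu]_x c%:E = c%:E)%E.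
Proof.
rewrite integral_cst// -[RHS]mule1; congr (_ * _)%E.
exact: probability_setT.
Qed.

Lemma normr_Rintegral_le d (T : measurableType d) (R : realType)
    (mu : probability T R) (f : T -> R) (c : R) :
  measurable_fun setT f -> (forall x, `|f x| <= c) -> `|\int[mu]_x f x| <= c.
Proof.
move=> mf fc; have fi := bounded_integrable mu mf fc.
apply: (le_trans (le_normr_Rintegral measurableT fi)).
rewrite -[leRHS](Rintegral_probability_cst mu c).
apply: le_Rintegral => //.
- exact: integrable_norm.
- exact: finite_measure_integrable_cst.
Qed.

Lemma sup_norm_ge0 d (T : measurableType d) (R : realType) (g : T -> R) :
  (0 <= sup_norm g)%E.
Proof.
apply: (@le_trans _ _ `|g point|%:E); first by rewrite lee_fin.
by apply: ereal_sup_ubound; exists point.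
Qed.

Lemma le_sup_norm d (T : measurableType d) (R : realType) (g : T -> R) x :
  (`|g x|%:E <= sup_norm g)%E.
Proof. by apply: ereal_sup_ubound; exists x. Qed.

(** * One step in expectation: sampling error and comparison with the gap *)

Section oracle_step.
Context d (T : measurableType d) dS (S : measurableType dS) (R : realType)
  dO (Omega : measurableType dO) (P : probability Omega R) (Y : {RV P >-> S})
  (J : probability T R -> R) (L : R) (H : probability T R -> T -> S -> R).
Context (Jwd : well_defined J) (Jcv : convex_functional J)
  (Jvm : forall mu, has_von_mises_derivative J mu)
  (L0 : 0 < L) (Jsm : smooth_functional J L)
  (H_measurable : measurable_fun setT
     (fun z : pprobability T R * T * S => H z.1.1 z.1.2 z.2))
  (H_unbiased : forall mu x,
     ('E_P[fun w => H mu x (Y w)] = (influence J mu x)%:E)%E).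
Context (n : nat) (n0 : (0 < n)%N) (Z : {RV P >-> n.-tuple S})
  (Ziid : iid_copies Y Z) (M : {RV P >-> pprobability T R})
  (MZ : forall A B, measurable A -> measurable B ->
     (P (M @^-1` A `&` Z @^-1` B) = P (M @^-1` A) * P (Z @^-1` B))%E).
Context (error_measurable : measurable_fun setT
     (fun z : pprobability T R * n.-tuple S =>
        sup_norm (fun x => oracle_mean H z.1 z.2 x - influence J z.1 x)))
  (e : R) (error_le : forall mu, (\int[P]_w ((Num.sqrt n%:R)%:E *
        sup_norm (fun x => oracle_mean H mu (Z w) x - influence J mu x)%R)
      <= (Num.sqrt n%:R * e)%:E)%E).

Let error (z : pprobability T R * n.-tuple S) : \bar R :=
  sup_norm (fun x => oracle_mean H z.1 z.2 x - influence J z.1 x).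

(** The error bound is given for a fixed measure; independence lets it be used with the random [M]
    frozen, after cancelling the factor [sqrt n]. *)
Lemma expected_error : (\int[P]_w error (M w, Z w) <= e%:E)%E.
Proof.
have err0 z : (0 <= error z)%E by exact: sup_norm_ge0.
rewrite (independent_ge0_integral MZ)//.
have inner mu : (\int[P]_w error (mu, Z w) <= e%:E)%E.
  have := error_le mu; rewrite ge0_integralZl//; last 2 first.
  - by apply: (measurableT_comp error_measurable
      (g := fun w => (mu : pprobability T R, Z w))); exact: measurable_fun_pair.
  - by move=> w _; exact: sup_norm_ge0.
  by rewrite EFinM lee_pmul2l// lte_fin sqrtr_gt0 ltr0n.
(* The bound at any single measure shows [e >= 0]; [M point] merely supplies one. *)
have e0 : (0 <= e%:E)%E.
  by apply: le_trans (inner (M point)); exact: integral_ge0.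
apply: (@le_trans _ _ (\int[P]_w e%:E)%E); last first.
  by rewrite integral_probability_cst.
apply: ge0_le_integral => //.
- by move=> w _; exact: integral_ge0.
- apply: (measurableT_comp (f := fun mu => \int[P]_w' error (mu, Z w'))%E) => //.
  apply: (@measurable_partial_integral _ (pprobability T R) _ Omega R P
    (fun z => error (z.1, Z z.2))).
  apply: (measurableT_comp error_measurable
    (g := fun z : pprobability T R * Omega => (z.1, Z z.2))).
  by apply: measurable_fun_pair => //; exact: measurableT_comp.
Qed.

Let minf := measurable_influence2 H_measurable H_unbiased.
Let inf_le mu x := normr_influence_le mu x Jwd Jvm L0 Jsm.

Let measurable_influence_comp (xh : Omega -> T) : measurable_fun setT xh ->
  measurable_fun setT (fun w => influence J (M w) (xh w)).
Proof.
by move=> mx; apply: (measurableT_comp minf (g := fun w => (M w, xh w)));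
  exact: measurable_fun_pair.
Qed.

Let integrable_influence_comp (xh : Omega -> T) : measurable_fun setT xh ->
  P.-integrable setT (EFin \o (fun w => influence J (M w) (xh w))).
Proof.
move=> mx; apply: (bounded_integrable P (c := L)) => //.
exact: measurable_influence_comp.
Qed.

Let integrable_error : P.-integrable setT (fun w => error (M w, Z w)).
Proof.
apply/integrableP; split.
  by apply: (measurableT_comp error_measurable (g := fun w => (M w, Z w)));
    exact: measurable_fun_pair.
under eq_integral do rewrite gee0_abs ?sup_norm_ge0//.
exact: (le_lt_trans expected_error (ltry _)).
Qed.

(* Comparing with a point x that does not depend on the sample costs the
   sampling error only once: at x the error has mean zero by unbiasedness. *)
Lemma expected_influence_argmin_le (xh : Omega -> T) x :
  measurable_fun setT xh ->
  (forall w, oracle_mean H (M w) (Z w) (xh w) <= oracle_mean H (M w) (Z w) x) ->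
  \int[P]_w influence J (M w) (xh w) <= \int[P]_w influence J (M w) x + e.
Proof.
move=> mx xmin.
pose D (z : pprobability T R * n.-tuple S) :=
  oracle_mean H z.1 z.2 x - influence J z.1 x.
have mD : measurable_fun setT D.
  apply: measurable_funB; first exact: measurable_oracle_mean.
  apply: (measurableT_comp minf (g := fun z => (z.1, x))).
  exact: measurable_fun_pair.
have iD : P.-integrable setT (fun w => (D (M w, Z w))%:E).
  apply: (le_integrable measurableT _ _ integrable_error).
    apply/measurable_EFinP; apply: (measurableT_comp mD) => //.
    exact: measurable_fun_pair.
  move=> w _; rewrite [leRHS]gee0_abs ?sup_norm_ge0//.
  exact: (le_sup_norm (fun x => oracle_mean H (M w) (Z w) x - influence J (M w) x)).
(* Unbiasedness centres [D] for each fixed measure, and independence carries this over to the random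
   [M w]. *)
have D0 : \int[P]_w D (M w, Z w) = 0.
  rewrite /Rintegral (independent_integral0 MZ (f := EFin \o D))//.
  - exact/measurable_EFinP.
  - move=> mu; have [iH _] := oracle_mean_integral H_measurable H_unbiased n0 Ziid mu x.
    have ic := finite_measure_integrable_cst P (influence J mu x) measurableT.
    exact: (integrableB measurableT iH ic).
  - move=> mu; have [iH eH] := oracle_mean_integral H_measurable H_unbiased n0 Ziid mu x.
    have ic := finite_measure_integrable_cst P (influence J mu x) measurableT.
    transitivity (\int[P]_w ((oracle_mean H mu (Z w) x)%:E -
      (EFin \o cst (influence J mu x)) w))%E; first by [].
    rewrite integralB// eH integral_probability_cst subee//.
have ix := integrable_influence_comp (xh := cst x) (measurable_cst _).
have ixh := integrable_influence_comp mx.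
(* Subtracting the centred [D] replaces the influence at [x] by the oracle mean at [x]. The choice
   of [xh] then bounds [G] pointwise by the error at [xh] alone. *)
pose G w := influence J (M w) (xh w) - influence J (M w) x - D (M w, Z w).
have iG : P.-integrable setT (EFin \o G).
  exact: (integrableB measurableT (integrableB measurableT ixh ix) iD).
have : \int[P]_w G w <= e.
  rewrite -lee_fin /Rintegral fineK; last exact: integrable_fin_num.
  apply: le_trans expected_error; apply: le_integral => // w _.
  apply: le_trans (le_sup_norm _ (xh w)); rewrite lee_fin.
  apply: (@le_trans _ _ (influence J (M w) (xh w) -
    oracle_mean H (M w) (Z w) (xh w))).
    by rewrite /G /D /=; have := xmin w; lra.
  by rewrite distrC ler_norm.
rewrite RintegralB//; last exact: (integrableB measurableT ixh ix).
by rewrite RintegralB// D0; lra.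
Qed.

(** The comparison point must not depend on the sample, so the previous bound is averaged over [x]
    under [nu] outside the expectation. After exchanging the integrals, the inner one is the
    derivative towards [nu], which convexity bounds by minus the gap. *)
Lemma expected_influence_le_gap (xh : Omega -> T) (nu : probability T R) :
  measurable_fun setT xh -> measurable_fun setT (fun w => J (M w)) ->
  (forall w x,
    oracle_mean H (M w) (Z w) (xh w) <= oracle_mean H (M w) (Z w) x) ->
  \int[P]_w influence J (M w) (xh w) <= - (\int[P]_w (J (M w) - J nu)) + e.
Proof.
move=> mx mJ xmin; set A := \int[P]_w _.
pose h2 (z : Omega * T) := influence J (M z.1) z.2.
have mh2 : measurable_fun setT h2.
  apply: (measurableT_comp minf (g := fun z : Omega * T => (M z.1, z.2))).
  by apply: measurable_fun_pair => //; exact: measurableT_comp.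
have mh1 w : measurable_fun setT (fun x => h2 (w, x)).
  by apply: (measurableT_comp mh2 (g := pair w)); exact: measurable_fun_pair.
have mh1' x : measurable_fun setT (fun w => h2 (w, x)).
  by apply: (measurableT_comp mh2 (g := pair^~ x)); exact: measurable_fun_pair.
have mphi : measurable_fun setT (fun x => \int[P]_w h2 (w, x)).
  apply: (measurableT_comp (f := fine)) => //.
  apply: (@measurable_partial_integral _ T _ Omega R P (fun z => (h2 (z.2, z.1))%:E)).
  apply/measurable_EFinP; apply: (measurableT_comp mh2 (g := fun z => (z.2, z.1))).
  exact: measurable_fun_pair.
have mpsi : measurable_fun setT (fun w => \int[nu]_x h2 (w, x)).
  apply: (measurableT_comp (f := fine)) => //.
  apply: (@measurable_partial_integral _ Omega _ T R nu (EFin \o h2)).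
  exact/measurable_EFinP.
have phiL x : `|\int[P]_w h2 (w, x)| <= L.
  by apply: normr_Rintegral_le => // y; exact: inf_le.
have psiL w : `|\int[nu]_x h2 (w, x)| <= L.
  by apply: normr_Rintegral_le => // y; exact: inf_le.
have gapL w : `|J (M w) - J nu| <= L.
  rewrite ler_norml lerNl opprB; apply/andP; split;
  exact: (convex_gap_le _ _ Jwd Jcv Jvm L0 Jsm).
have : A - e <= \int[nu]_x \int[P]_w h2 (w, x).
  rewrite -(Rintegral_probability_cst nu (A - e)); apply: le_Rintegral => //.
  - exact: finite_measure_integrable_cst.
  - exact: (bounded_integrable nu mphi phiL).
  - move=> x _; rewrite lerBlDr; exact: expected_influence_argmin_le.
rewrite -(bounded_Rintegral_exchange P nu (c := L))//; last first.
  by move=> z; exact: inf_le.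
have : \int[P]_w \int[nu]_x h2 (w, x) <= \int[P]_w (- (J (M w) - J nu)).
  apply: le_Rintegral => //.
  - exact: (bounded_integrable P mpsi psiL).
  - apply: (bounded_integrable P (c := L)) => [|w]; last by rewrite normrN.
    by apply: measurableT_comp => //; apply: measurable_funB.
  - move=> w _; rewrite opprB.
    apply: le_trans (convex_directional_derivative_le nu Jcv (Jvm (M w))).
    by rewrite directional_derivativeE.
have -> : \int[P]_w (- (J (M w) - J nu)) = - (\int[P]_w (J (M w) - J nu)).
  rewrite -[RHS]mulN1r -RintegralZl//.
    by apply: eq_Rintegral => w _; rewrite mulN1r.
  apply: (bounded_integrable P (c := L)) => //.
  exact: measurable_funB.
by move=> psi_le A_le; rewrite -lerBlDr; exact: le_trans A_le psi_le.
Qed.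

End oracle_step.

(** * The recursion for the expected gap and its rate *)

Theorem theorem2 (R : realType) (d : nat) (X : set 'rV[R]_d)
  (X_nonempty : X !=set0) (X_compact : compact X)
  (J : probability (borel X_nonempty) R -> R)
  (J_well_defined : well_defined J)
  (J_von_mises : forall mu, has_von_mises_derivative J mu)
  (J_convex : convex_functional J)
  (L : R) (L_gt0 : 0 < L) (J_smooth : smooth_functional J L)
  (mustar : probability (borel X_nonempty) R)
  (mustar_argmin : forall mu, J mustar <= J mu)
  (diam_gt0 : 0 < tv_diameter (borel X_nonempty) R)
  (dS : measure_display) (S : measurableType dS)
  (dO : measure_display) (Omega : measurableType dO) (P : probability Omega R)
  (Y : {RV P >-> S})
  (H : probability (borel X_nonempty) R -> borel X_nonempty -> S -> R)
  (H_measurable : measurable_fun setT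
     (fun z : pprobability (borel X_nonempty) R * borel X_nonempty * S =>
        H z.1.1 z.1.2 z.2))
  (error_measurable : forall m : nat, (0 < m)%N -> measurable_fun setT
     (fun z : pprobability (borel X_nonempty) R * m.-tuple S =>
        sup_norm (fun x => oracle_mean H z.1 z.2 x - influence J z.1 x)))
  (H_unbiased : forall mu x,
     ('E_P[fun w => H mu x (Y w)] = (influence J mu x)%:E)%E)
  (c0 : R)
  (error_bound : forall mu (m : nat) (Z : {RV P >-> m.-tuple S}),
     (0 < m)%N -> iid_copies Y Z ->
     (\int[P]_w ((Num.sqrt m%:R)%:E *
        sup_norm (fun x => oracle_mean H mu (Z w) x - influence J mu x)%R)
      <= c0%:E)%E)
  (m : nat -> nat)
  (m_gt0 : forall k, (0 < k)%N -> (0 < m k)%N)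
  (m_ge : forall k, (0 < k)%N ->
     (c0 * (k%:R + 2) / (L * tv_diameter (borel X_nonempty) R)) ^+ 2
       <= (m k)%:R)
  (F : nat -> set (set Omega)) (F_filtration : is_filtration F)
  (batch : forall k, {RV P >-> (m k).-tuple S})
  (batch_iid : forall k, (0 < k)%N -> iid_copies Y (batch k))
  (batch_adapted : forall k, (0 < k)%N -> measurable_wrt (F k) (batch k))
  (batch_fresh : forall k, independent_of P (F k) (batch k.+1))
  (mu0 : probability (borel X_nonempty) R)
  (xhat : nat -> Omega -> borel X_nonempty)
  (xhat_adapted : forall k, (0 < k)%N -> measurable_wrt (F k) (xhat k))
  (xhat_argmin : forall k w x,
     oracle_mean H (fw_iterate mu0 xhat k w) (batch k.+1 w) (xhat k.+1 w)
       <= oracle_mean H (fw_iterate mu0 xhat k w) (batch k.+1 w) x)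
  (J_iterate_measurable : forall k,
     measurable_fun setT (fun w => J (fw_iterate mu0 xhat k w))) :
  forall k, (1 <= k)%N ->
    ('E_P[fun w => (J (fw_iterate mu0 xhat k w) - J mustar)%R]
      <= (4 * L * tv_diameter (borel X_nonempty) R ^+ 2 / (k%:R + 2))%:E)%E.
Proof.
have D1 := tv_diameter_eq1 diam_gt0.
have [sF Fsub incF] := F_filtration.
pose it k w := fw_iterate mu0 xhat k w.
have itF k : measurable_wrt (F k) (it k : Omega -> pprobability (borel X_nonempty) R).
  exact: fw_iterate_adapted.
have mit k : measurable_fun setT (it k : Omega -> pprobability (borel X_nonempty) R).
  by move=> _ A mA; rewrite setTI; apply/Fsub/itF.
pose M k : {RV P >-> pprobability (borel X_nonempty) R} := HB.pack
  (it k : Omega -> pprobability (borel X_nonempty) R)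
  (isMeasurableFun.Build _ _ _ _ _ (mit k)).
have mxhat k : measurable_fun setT (xhat k.+1).
  by move=> _ A mA; rewrite setTI; apply/(Fsub k.+1)/xhat_adapted.
have gapL k w : `|J (it k w) - J mustar| <= L.
  rewrite ger0_norm ?subr_ge0//.
  exact: (convex_gap_le _ _ J_well_defined J_convex J_von_mises L_gt0 J_smooth).
have mgap k : measurable_fun setT (fun w => J (it k w) - J mustar).
  by apply: measurable_funB => //; exact: J_iterate_measurable.
have igap k := bounded_integrable P (mgap k) (gapL k).
pose gap k := \int[P]_w (J (it k w) - J mustar).
pose h k w := influence J (it k w) (xhat k.+1 w).
have ih k : P.-integrable setT (EFin \o h k).
  apply: (bounded_integrable P (c := L)) => [|w]; last first.
    exact: (normr_influence_le _ _ J_well_defined J_von_mises L_gt0 J_smooth).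
  apply: (measurableT_comp (measurable_influence2 H_measurable H_unbiased)
    (g := fun w => (M k w, xhat k.+1 w))).
  exact: measurable_fun_pair.
have h_le k : \int[P]_w h k w <= - gap k + L / (k%:R + 3).
  apply: (expected_influence_le_gap J_well_defined J_convex J_von_mises L_gt0
    J_smooth H_measurable H_unbiased (m_gt0 _ (ltn0Sn k)) (batch_iid _ (ltn0Sn k))
    (M := M k)).
  - move=> A B mA mB; apply: batch_fresh => //; exact: itF.
  - exact: error_measurable (m_gt0 _ (ltn0Sn k)).
  - move=> mu.
    apply: (le_trans (error_bound mu _ (batch k.+1) (m_gt0 _ (ltn0Sn k))
      (batch_iid _ (ltn0Sn k)))).
    (* Step [k] uses batch [k + 1], whose size gives [c0 <= sqrt m * (L / (k + 3))]; hence
       [L / (k + 3)] as expected error. *)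
    have := m_ge k.+1 isT; rewrite D1 mulr1 lee_fin -natr1.
    move=> /ler_wsqrtr; rewrite sqrtr_sqr => /(le_trans (ler_norm _)).
    have k0 : 0 <= k%:R :> R by [].
    have k3 : 0 < k%:R + 3 :> R by lra.
    rewrite ler_pdivrMr// mulrA ler_pdivlMr//.
    by have -> : k%:R + 1 + 2 = k%:R + 3 :> R by ring.
  - exact: mxhat.
  - exact: J_iterate_measurable.
  - exact: xhat_argmin.
have gap_le k : gap k <= L.
  by apply: (le_trans (ler_norm _)); exact: normr_Rintegral_le.
have gap_step k : (0 < k)%N -> gap k.+1 <= gap k +
      (fw_step R k + 2 / (k%:R * (k%:R + 2))) * (- gap k + L / (k%:R + 3)) +
      2 / (k%:R * (k%:R + 2)) * L.
  (* Here [r = eta^2 / (2 (1 - eta))] for [eta = 2 / (k + 2)], which requires [k >= 1] because the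
     step size at 0 is 1. *)
  move=> k0; set r := 2 / _; have k1 : 1 <= k%:R :> R by rewrite ler1n.
  set s := fw_step R k + r.
  have s0 : 0 <= s by rewrite /s /r /fw_step addr_ge0// divr_ge0// ?mulr_ge0; lra.
  have irL : P.-integrable setT (EFin \o (fun w => J (it k w) - J mustar + r * L)).
    exact: (integrableD measurableT (igap k)
      (finite_measure_integrable_cst P (r * L) measurableT)).
  have ish : P.-integrable setT (EFin \o (fun w => s * h k w)).
    exact: (integrableZl measurableT s (ih k)).
  (* The descent bound regroups as gap plus [r L] plus [s h] with [s = eta + r]. Since [s >= 0], the
     expected bound on [h] can be inserted after integration. *)
  apply: (@le_trans _ _ (\int[P]_w (J (it k w) - J mustar + r * L + s * h k w))).
    apply: le_Rintegral => //.
      exact: (integrableD measurableT irL ish).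
    move=> w _.
    have eta0 : 0 < fw_step R k by rewrite /fw_step divr_gt0; lra.
    have eta1 : fw_step R k < 1 by rewrite /fw_step ltr_pdivrMr; lra.
    have := fw_descent (it k w) (xhat k.+1 w) J_well_defined J_convex J_von_mises
      L_gt0 J_smooth eta0 eta1.
    have -> : fw_step R k ^+ 2 / (2 * (1 - fw_step R k)) = r.
      by rewrite /r /fw_step; field; lra.
    rewrite -/(it k.+1 w) -/(h k w) /s; lra.
  rewrite RintegralD// RintegralD//; last first.
    exact: finite_measure_integrable_cst.
  rewrite Rintegral_probability_cst RintegralZl// -/(gap k).
  have := ler_wpM2l s0 (h_le k); lra.
have gap_rate k : (0 < k)%N -> gap k <= 4 * L / (k%:R + 2).
  (* At [k = 1, 2] the target is at least [L], so the crude bound suffices; the recursion takes over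
     from [k = 2] to [k = 3] onwards. *)
  elim: k => // -[_ _|[_ _|k IH _]].
  - by rewrite (le_trans (gap_le _))// ler_pdivlMr; lra.
  - by rewrite (le_trans (gap_le _))// ler_pdivlMr; lra.
  - apply: (le_trans (gap_step k.+2 isT)).
    have -> : k.+3%:R + 2 = k.+2%:R + 3 :> R by rewrite -[k.+3%:R]natr1; ring.
    by apply: fw_rate_step => //; exact: IH.
move=> k k1; rewrite D1 expr1n mulr1 unlock.
have := gap_rate k k1; rewrite -lee_fin /gap /Rintegral fineK//.
exact: (integrable_fin_num measurableT (igap k)).
Qed.
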